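(* Let $\mathbb{F}_q$ be a finite field with $q$ elements, let $d\ge 2$ be an even integer, and let $E\subset \mathbb{F}_q^d$. If $|E|\ge 9q^{d/2}$, then $$\mathbb{F}_q=\frac{\Delta(E)}{\Delta(E)}.$$
   Context: Here $\mathbb{F}_q^d$ is the $d$-dimensional vector space over $\mathbb{F}_q$. For $x=(x_1,\dots,x_d)\in\mathbb{F}_q^d$ put $\|x\|=x_1^2+\cdots+x_d^2\in\mathbb{F}_q$. For $E\subset\mathbb{F}_q^d$ the distance set is $\Delta(E)=\{\|x-y\|: x,y\in E\}\subset\mathbb{F}_q$, and its quotient set is $$\frac{\Delta(E)}{\Delta(E)}=\left\{\frac{a}{b}: a\in\Delta(E),\ b\in\Delta(E)\setminus\{0\}\right\}.$$
   Formalization: The hypothesis that q is odd is added; for even q the claim is false, e.g. d = 2, q = 2^10, E = {x : x_1+x_2 in F_32} has |E| = 32q ≥ 9q but Δ(E)/Δ(E) = F_32. *)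

(* Defs.v *)
From HB Require Import structures.
From mathcomp Require Import all_boot all_order all_algebra.
Set Implicit Arguments.
Unset Strict Implicit.
Unset Printing Implicit Defensive.
Import GRing.Theory.
Local Open Scope ring_scope.

(* This is the quadratic form x_1^2 + ... + x_d^2 with values in F,
   not a norm in the sense of ordered fields. *)
Definition sqnorm (F : finFieldType) (d : nat) (x : 'rV[F]_d) : F :=
  \sum_(i < d) x 0 i ^+ 2.

Definition distance_set (F : finFieldType) (d : nat) (E : {set 'rV[F]_d}) :
    {set F} :=
  [set sqnorm (x - y) | x in E, y in E].

(* Zero is removed from the denominators because 0^-1 = 0 in MathComp. *)
Definition quotient_set (F : finFieldType) (D : {set F}) : {set F} :=
  [set a / b | a in D, b in D :\ 0].

(* Main.v *)
(* Let nu(t) be the number of pairs in E x E at distance t, n = |E| and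
   k = q^(d/2).  For r <> 0 it suffices that sum_t nu(t) nu(r t) > nu(0)^2,
   since then some t <> 0 has both t and r t in the distance set.  Let B(t) be
   the mass of |E^|^2 on {|m| = t}, so B >= 0 and sum_t B(t) = q^d n.  As d is
   even, the d-th powers of the Gauss sums all equal one c = +-k, and completing
   the square gives c nu^(s) = B^(-1/(4s)) for s <> 0.  Plancherel then yields
     q sum_t nu(t) nu(r t) = n^4 - q^d n^2 + (q / q^d) sum_t B(t) B(t / r),
     q nu(0) = n^2 +- (q B(0) / k - k n).
   Keeping only the term B(0)^2 of the last sum in the first line, which is
   exactly the dangerous part of nu(0)^2, the inequality follows from n >= 9k
   and B(0) <= q^d n. *)
Require Import Defs.
From HB Require Import structures.
From mathcomp Require Import all_boot all_order all_algebra.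
From mathcomp Require Import all_fingroup all_solvable all_field all_character.
From mathcomp Require Import ring lra.

(** * The numerical inequality *)

Section Numeric.
Import Order.TTheory GRing.Theory Num.Theory.
Local Open Scope ring_scope.

(* In the application [m = q B(0) / k], [v = nu(0)] and [N] is the correlation
   sum; everything is cleared of denominators. *)
Lemma sqr_lt_of_spectral_bound (R : realDomainType) (q k n m v N : R) :
  3 <= q -> 1 <= k -> 9 * k <= n -> 0 <= m <= q * k * n -> 0 <= v ->
  q * n ^+ 4 + m ^+ 2 - q * k ^+ 2 * n ^+ 2 <= q ^+ 2 * N ->
  q * v = n ^+ 2 + (m - k * n) \/ q * v = n ^+ 2 - (m - k * n) ->
  v ^+ 2 < N.
Proof.
move=> q3 k1 kn /andP[m0 mq] v0 hN hv.
have q0 : 0 < q by lra.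
have n0 : 0 < n by lra.
have n4 : 0 < n ^+ 4 by rewrite exprn_gt0.
have qn4 : 3 * n ^+ 4 <= q * n ^+ 4 by rewrite ler_pM2r.
have kn2 : 9 * (k * n) <= n ^+ 2 by rewrite mulrA expr2 ler_pM2r.
have h1 : 81 * (q * k ^+ 2 * n ^+ 2) <= q * n ^+ 4.
  have : (9 * (k * n)) ^+ 2 <= (n ^+ 2) ^+ 2 by rewrite lerXn2r ?nnegrE //; nra.
  by rewrite -(ler_pM2l q0); lra.
have kn0 : 0 < k * n by rewrite mulr_gt0; lra.
rewrite -(ltr_pM2l (exprn_gt0 2 q0)); apply: lt_le_trans hN; rewrite -exprMn.
case: hv => hv; rewrite hv.
  (* Expanding the square of (n^2 - k n) + m, the term m^2 cancels against the one in [hN]. The rest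
     is at most n^4 + 2 q k n^3 <= (1/3 + 2/9) q n^4, below the available (80/81) q n^4. *)
  have h2 : m * (n ^+ 2 - k * n) <= q * k * n * n ^+ 2.
    by apply: ler_pM => //; lra.
  have h3 : 9 * (q * k * n * n ^+ 2) <= q * n ^+ 4.
    have : q * n ^+ 2 * (9 * (k * n)) <= q * n ^+ 2 * n ^+ 2.
      by rewrite ler_pM2l // mulr_gt0 // exprn_gt0.
    by lra.
  have h4 : (n ^+ 2 - k * n) ^+ 2 <= (n ^+ 2) ^+ 2.
    by rewrite lerXn2r ?nnegrE //; lra.
  lra.
have vq0 : 0 <= q * v by rewrite mulr_ge0 // ltW.
(* Now q v <= n^2 + k n <= (10/9) n^2, and (10/9)^2 is less than 3 times 80/81. *)
have h5 : (9 * (n ^+ 2 - (m - k * n))) ^+ 2 <= (10 * n ^+ 2) ^+ 2.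
  by rewrite lerXn2r ?nnegrE //; lra.
have m2 : 0 <= m ^+ 2 by rewrite exprn_ge0.
lra.
Qed.

End Numeric.

(** * Additive characters of a finite field *)

Section AdditiveCharacters.
Import Order.TTheory GRing.Theory Num.Theory.
Local Open Scope ring_scope.

Lemma exists_additive_character (F : finFieldType) :
  exists chi : F -> algC,
    [/\ {morph chi : a b / a + b >-> a * b}, forall a, chi (- a) = (chi a)^*,
        chi 0 = 1 & exists a, chi a != 1].
Proof.
pose G := [set: F]%G.
have abF : abelian G by apply/centsP=> a _ b _; exact: addrC.
(* An abelian group has as many irreducible characters as elements, so index 1 exists; index 0 is
   the trivial character. *)
have N1 : (1 < Nirr G)%N.
  rewrite NirrE; move: abF; rewrite card_classes_abelian => /eqP ->.
  by rewrite cardsT finNzRing_gt1.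
pose i : Iirr G := Ordinal N1.
have lin : 'chi_i \is a linear_char by move/char_abelianP: abF.
exists 'chi_i; split.
- by move=> a b; exact: (lin_charM lin (in_setT a) (in_setT b)).
- by move=> a; exact: (lin_charV_conj lin (in_setT a)).
- exact: (lin_char1 lin).
have : 'chi_i != 'chi_(0 : Iirr G) by rewrite (inj_eq irr_inj).
rewrite irr0 => neq1; apply/existsP; apply: contraNT neq1.
rewrite negb_exists => /forallP eq1; apply/eqP/cfunP => a.
by rewrite cfun1E in_setT; apply/eqP; move: (eq1 a); rewrite negbK.
Qed.

(** Translating the index by [a] multiplies the sum by [f a], which is not 1. *)
Lemma sum_multiplicative_eq0 (V : finZmodType) (f : V -> algC) :
  {morph f : a b / a + b >-> a * b} -> (exists a, f a != 1) ->
  \sum_a f a = 0.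
Proof.
move=> fD [a fa].
have : (f a - 1) * \sum_b f b = 0.
  rewrite mulrBl mul1r mulr_sumr [X in _ - X](reindex_inj (addrI a)) /=.
  by rewrite -sumrB big1 // => b _; rewrite fD subrr.
by move/eqP; rewrite mulf_eq0 subr_eq0 (negPf fa) => /eqP.
Qed.

End AdditiveCharacters.

(** * Quadratic Gauss sums in odd characteristic *)

Section GaussSums.
Import Order.TTheory GRing.Theory Num.Theory.
Local Open Scope ring_scope.

Lemma two_neq0 (F : finFieldType) : odd #|F| -> (2%:R : F) != 0.
Proof.
move=> oddq; apply/negP => /eqP two0.
have o2 : #[1%R : F]%g = 2.
  apply: nt_prime_order => //.
  exact: oner_neq0.
have := order_dvdG (in_setT (1%R : F)).
by rewrite o2 cardsT dvdn2 oddq.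
Qed.

Variables (F : finFieldType) (chi : F -> algC).
Hypothesis oddq : odd #|F|.
Hypothesis chiD : {morph chi : a b / a + b >-> a * b}.
Hypothesis chiN : forall a, chi (- a) = (chi a)^*.
Hypothesis chi0 : chi 0 = 1.
Hypothesis chi_nontrivial : exists a, chi a != 1.

Local Notation q := (#|F|%:R : algC).

Lemma sum_chiM (c : F) : \sum_a chi (a * c) = q *+ (c == 0).
Proof.
have [->|c0] := eqVneq c 0.
  by under eq_bigr do rewrite mulr0 chi0; rewrite sumr_const.
apply: sum_multiplicative_eq0 => [a b|]; first by rewrite mulrDl chiD.
by have [a ha] := chi_nontrivial; exists (a / c); rewrite divfK.
Qed.

Definition gauss_sum (s : F) : algC := \sum_x chi (s * x ^+ 2).

(** Substituting x = y + h makes the exponent affine in y with slope 2 s h; since 2 is invertible,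
    the sum over y keeps only h = 0. *)
Lemma gauss_sumMN (s : F) : s != 0 -> gauss_sum s * gauss_sum (- s) = q.
Proof.
move=> s0; rewrite mulr_suml.
under eq_bigr do rewrite mulr_sumr.
transitivity (\sum_h \sum_y chi (y * (2%:R * s * h)) * chi (s * h ^+ 2)).
  rewrite [LHS]exchange_big [RHS]exchange_big /=; apply: eq_bigr => y _.
  rewrite (reindex_inj (addrI y)) /=; apply: eq_bigr => h _.
  by rewrite -!chiD; congr chi; ring.
under eq_bigr do rewrite -mulr_suml sum_chiM.
rewrite (bigD1 0) //= mulr0 eqxx expr0n mulr0 chi0 mulr1 big1 ?addr0 //.
move=> h h0; rewrite !mulf_eq0 (negPf h0) (negPf s0).
by rewrite (negPf (two_neq0 F oddq)) mul0r.
Qed.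

Definition sqrt_count (y : F) : nat := #|[set x : F | x ^+ 2 == y]|.

Lemma sum_sqrt_count (f : F -> algC) :
  \sum_x f (x ^+ 2) = \sum_y (sqrt_count y)%:R * f y.
Proof.
rewrite (partition_big (fun x => x ^+ 2) xpredT) //=; apply: eq_bigr => y _.
rewrite (eq_bigr (fun=> f y)) => [|x /eqP -> //].
rewrite sumr_const mulr_natl; congr (_ *+ _).
by apply: eq_card => x; rewrite !inE.
Qed.

Lemma sum_sqrt_count_card : (\sum_y sqrt_count y = #|F|)%N.
Proof.
apply/eqP; rewrite -(eqr_nat algC) natr_sum.
have /= := sum_sqrt_count (fun=> 1); rewrite sumr_const => ->.
by under [X in _ == X]eq_bigr do rewrite mulr1.
Qed.

Lemma sqrt_count_le2 (x : F) : (sqrt_count (x ^+ 2)%R <= 1 + (x != 0%R))%N.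
Proof.
rewrite /sqrt_count; have -> : [set z : F | z ^+ 2 == x ^+ 2] = [set x; - x].
  by apply/setP=> z; rewrite !inE eqf_sqr.
rewrite cards2; have [->|_] := eqVneq x 0%R; first by rewrite oppr0 eqxx.
by case: (x == - x).
Qed.

(** If a^2 = y and b^2 = y / s with b nonzero, then s would be the square of a / b. So both counts
    are positive only at y = 0, where each is 1. *)
Lemma sqrt_count_nonsquare (s y : F) : (forall x, x ^+ 2 != s) ->
  (sqrt_count y + sqrt_count (y / s) <= 2)%N.
Proof.
move=> nsq.
have s0 : s != 0 by have := nsq 0; rewrite expr0n eq_sym.
have small x : (sqrt_count (x ^+ 2)%R <= 2)%N.
  by apply: leq_trans (sqrt_count_le2 x) _; case: (x != 0).
have [|] := posnP (sqrt_count y) => [ny|/card_gt0P[a]].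
  rewrite ny add0n; have [|] := posnP (sqrt_count (y / s)) => [-> //|].
  by case/card_gt0P=> b; rewrite inE => /eqP <-.
rewrite inE => /eqP defy.
have [|] := posnP (sqrt_count (y / s)) => [nys|/card_gt0P[b]].
  by rewrite nys addn0 -defy.
rewrite inE => /eqP defb.
have b0 : b == 0.
  apply: contraT => b0; have /negP[] := nsq (a / b).
  rewrite exprMn exprVn defb defy invfM invrK mulrA divff ?mul1r //.
  by apply: contraNneq b0 => y0; rewrite -sqrf_eq0 defb y0 mul0r.
have a0 : a == 0.
  move: defb; rewrite -defy (eqP b0) expr0n => /esym/eqP.
  by rewrite mulf_eq0 invr_eq0 (negPf s0) orbF sqrf_eq0.
rewrite -defb -defy.
apply: leq_trans (leq_add (sqrt_count_le2 a) (sqrt_count_le2 b)) _.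
by rewrite a0 b0.
Qed.

Lemma gauss_sum_pm (s : F) : s != 0 ->
  gauss_sum s = gauss_sum 1 \/ gauss_sum s = - gauss_sum 1.
Proof.
move=> s0; case: (boolP [exists x, x ^+ 2 == s]) => [/existsP[a /eqP sa]|].
  left; rewrite /gauss_sum [RHS](reindex_inj (mulfI (x := a) _)) /=; last first.
    by rewrite -sqrf_eq0 sa.
  by apply: eq_bigr => x _; rewrite mul1r exprMn sa.
rewrite negb_exists => /forallP nsq; right.
(* The maps [x ^+ 2] and [s * x ^+ 2] together cover each point exactly twice,
   so the two Gauss sums add up to a full character sum. *)
have cnt2 y : (sqrt_count y + sqrt_count (y / s) = 2)%N.
  (* Each term is at most 2 and the terms add up to twice the order of the field, so equality holds
     at every point. *)
  have le2 z : xpredT z -> (sqrt_count z + sqrt_count (z / s) <= 2 ?= iff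
      (sqrt_count z + sqrt_count (z / s) == 2))%N.
    by move=> _; split=> //; apply: sqrt_count_nonsquare.
  have [_] := leqif_sum le2.
  have -> : (\sum_y (sqrt_count y + sqrt_count (y / s)) = #|F| + #|F|)%N.
    rewrite big_split /= -sum_sqrt_count_card; congr addn.
    by rewrite [RHS](reindex_inj (mulIf (invr_neq0 s0))).
  rewrite sum_nat_const muln2 addnn eqxx.
  by move=> /esym/forallP/(_ y)/eqP.
apply/eqP; rewrite -addr_eq0 /gauss_sum; apply/eqP.
rewrite (sum_sqrt_count (fun y => chi (s * y))).
rewrite (sum_sqrt_count (fun y => chi (1 * y))).
rewrite (reindex_inj (mulIf (x := s^-1) _)) ?invr_eq0 //= -big_split /=.
rewrite (eq_bigr (fun y => 2%:R * chi (y * 1))) => [|y _].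
  by rewrite -mulr_sumr sum_chiM oner_eq0 mulr0.
by rewrite -(cnt2 y) natrD mulrDl addrC mulr1 mul1r mulrCA divff ?mulr1.
Qed.

(** The square of the Gauss sum does not depend on [s], and comparing [gauss_sum 1] with
    [gauss_sum (- 1)] in [gauss_sumMN] shows that it is q or -q. *)
Lemma gauss_sum_even_power (d : nat) : ~~ odd d ->
  exists e : bool, forall s, s != 0 ->
    gauss_sum s ^+ d = (-1) ^+ e * q ^+ (d %/ 2).
Proof.
move=> even_d.
have -> : d = (2 * (d %/ 2))%N by rewrite mulnC divnK // dvdn2.
rewrite mulKn //; set h := (d %/ 2)%N.
have g2 s : s != 0 -> gauss_sum s ^+ 2 = gauss_sum 1 ^+ 2.
  by move=> /gauss_sum_pm[->|->]; rewrite ?sqrrN.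
have N1 : (-1 : F) != 0 by rewrite oppr_eq0 oner_eq0.
have := gauss_sumMN _ (oner_neq0 F); have [->|->] := gauss_sum_pm _ N1 => gq.
  by exists false => s s0; rewrite exprM g2 // expr2 gq mul1r.
exists (odd h) => s s0; rewrite exprM g2 // expr2.
by rewrite signr_odd -exprMn -gq mulrN mulN1r opprK.
Qed.

(** * Fourier duality between distance counts and spectral mass *)

Section Distances.
Variable d : nat.
Implicit Types (m u x y : 'rV[F]_d) (E : {set 'rV[F]_d}).

Definition dot m x : F := \sum_(i < d) m 0 i * x 0 i.

Lemma dotDl m u x : dot (m + u) x = dot m x + dot u x.
Proof.
by rewrite /dot -big_split; apply: eq_bigr => i _; rewrite mxE mulrDl.
Qed.

Lemma dotBr m x y : dot m (x - y) = dot m x - dot m y.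
Proof. by rewrite /dot -sumrB; apply: eq_bigr => i _; rewrite !mxE mulrBr. Qed.

Lemma chi_sum (I : finType) (f : I -> F) : chi (\sum_i f i) = \prod_i chi (f i).
Proof. by apply: big_morph. Qed.

Lemma sum_chi_sqnorm (s : F) :
  \sum_(m : 'rV[F]_d) chi (s * sqnorm m) = gauss_sum s ^+ d.
Proof.
rewrite -[in RHS](card_ord d) -prodr_const bigA_distr_bigA /=.
rewrite (reindex (fun f : {ffun 'I_d -> F} => \row_i f i)) /=; last first.
  exists (fun m => [ffun i => m 0 i]) => [f _|m _].
    by apply/ffunP=> i; rewrite ffunE mxE.
  by apply/rowP=> i; rewrite mxE ffunE.
apply: eq_bigr => f _; rewrite mulr_sumr chi_sum; apply: eq_bigr => i _.
by rewrite mxE.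
Qed.

Lemma sum_chi_dot u : \sum_(m : 'rV[F]_d) chi (dot m u) = q ^+ d *+ (u == 0).
Proof.
have [->|u0] := eqVneq u 0.
  rewrite (eq_bigr (fun=> 1)) => [|m _].
    by rewrite sumr_const card_mx mul1n natrX.
  by rewrite /dot big1 ?chi0 // => i _; rewrite mxE mulr0.
apply: sum_multiplicative_eq0 => [a b|]; first by rewrite dotDl chiD.
have [i ui] : exists i, u 0 i != 0.
  apply/existsP; apply: contraNT u0; rewrite negb_exists => /forallP u0.
  by apply/eqP/rowP=> i; rewrite mxE; apply/eqP; move: (u0 i); rewrite negbK.
(* This witness has dot product [a] with [u]. *)
have [a ha] := chi_nontrivial; exists ((a / u 0 i) *: delta_mx 0 i).
rewrite /dot (bigD1 i) //= big1 => [|j ji].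
  by rewrite !mxE !eqxx mulr1 addr0 divfK.
by rewrite !mxE (negPf ji) andbF mulr0 mul0r.
Qed.

(** Unnormalised and without conjugation, hence the factor q and the frequency [- s] in
    [plancherel]. *)
Definition fourier (a : F -> algC) (s : F) : algC := \sum_t a t * chi (s * t).

Lemma fourier0 (a : F -> algC) : fourier a 0 = \sum_t a t.
Proof. by apply: eq_bigr => t _; rewrite mul0r chi0 mulr1. Qed.

Lemma sum_fourier (a : F -> algC) : \sum_s fourier a s = q * a 0.
Proof.
rewrite exchange_big /=.
under eq_bigr do rewrite -mulr_sumr sum_chiM.
rewrite (bigD1 0) //= eqxx big1 ?addr0 1?mulrC // => t /negPf ->.
by rewrite mulr0.
Qed.

Lemma plancherel (a b : F -> algC) :
  \sum_s fourier a s * fourier b (- s) = q * \sum_t a t * b t.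
Proof.
transitivity (\sum_t \sum_u (a t * b u) * \sum_s chi (s * (t - u))).
  under eq_bigr do rewrite mulr_suml; rewrite exchange_big /=.
  apply: eq_bigr => t _; under eq_bigr do rewrite mulr_sumr.
  rewrite exchange_big /=; apply: eq_bigr => u _; rewrite mulr_sumr.
  by apply: eq_bigr => s _; rewrite mulrBr chiD -mulNr mulrACA.
rewrite mulr_sumr; apply: eq_bigr => t _.
rewrite (bigD1 t) //= sum_chiM subrr eqxx big1 => [|u ut].
  by rewrite addr0 mulrC.
by rewrite sum_chiM subr_eq0 eq_sym (negPf ut) mulr0.
Qed.

(** This is nu of the outline; [spectral_mass] is B, with E^ unnormalised. *)
Definition pair_count E (t : F) : nat :=
  \sum_(x in E) \sum_(y in E) (sqnorm (x - y) == t).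

Definition spectral_mass E (t : F) : algC :=
  \sum_(m : 'rV[F]_d | sqnorm m == t) `|\sum_(x in E) chi (dot m x)| ^+ 2.

Lemma spectral_mass_ge0 E t : 0 <= spectral_mass E t.
Proof. by apply: sumr_ge0 => m _; rewrite exprn_ge0. Qed.

Lemma fourier_pair_count E s :
  fourier (fun t => (pair_count E t)%:R) s =
  \sum_(x in E) \sum_(y in E) chi (s * sqnorm (x - y)).
Proof.
rewrite /fourier; under eq_bigr do rewrite natr_sum mulr_suml.
rewrite exchange_big /=; apply: eq_bigr => x _.
under eq_bigr do rewrite natr_sum mulr_suml.
rewrite exchange_big /=; apply: eq_bigr => y _.
rewrite (bigD1 (sqnorm (x - y))) //= eqxx mul1r big1 ?addr0 // => t.
by rewrite eq_sym => /negPf ->; rewrite mul0r.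
Qed.

Lemma norm_sum_chi E m :
  `|\sum_(x in E) chi (dot m x)| ^+ 2 =
  \sum_(x in E) \sum_(y in E) chi (dot m (x - y)).
Proof.
rewrite normCK raddf_sum mulr_suml; apply: eq_bigr => x _.
by rewrite mulr_sumr; apply: eq_bigr => y _; rewrite dotBr chiD chiN.
Qed.

(** By orthogonality in [m] only the diagonal pairs x = y survive. *)
Lemma sum_spectral_mass E : \sum_t spectral_mass E t = q ^+ d * #|E|%:R.
Proof.
transitivity (\sum_(m : 'rV[F]_d) `|\sum_(x in E) chi (dot m x)| ^+ 2).
  by rewrite [RHS](partition_big (@sqnorm F d) xpredT).
under eq_bigr do rewrite norm_sum_chi.
rewrite exchange_big /= mulr_natr -sumr_const; apply: eq_bigr => x xE.
rewrite exchange_big /= (bigD1 x) //= sum_chi_dot subrr eqxx.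
rewrite big1 ?addr0 // => y /andP[_ yx].
by rewrite sum_chi_dot subr_eq0 eq_sym (negPf yx).
Qed.

Lemma fourier_spectral_mass E s :
  fourier (spectral_mass E) s =
  \sum_(x in E) \sum_(y in E)
    \sum_(m : 'rV[F]_d) chi (dot m (x - y) + s * sqnorm m).
Proof.
transitivity (\sum_(m : 'rV[F]_d)
    `|\sum_(x in E) chi (dot m x)| ^+ 2 * chi (s * sqnorm m)).
  rewrite (partition_big (@sqnorm F d) xpredT) //=; apply: eq_bigr => t _.
  by rewrite mulr_suml; apply: eq_bigr => m /eqP ->.
under eq_bigr do rewrite norm_sum_chi mulr_suml.
rewrite exchange_big /=; apply: eq_bigr => x _.
under eq_bigr do rewrite mulr_suml.
rewrite exchange_big /=; apply: eq_bigr => y _.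
by apply: eq_bigr => m _; rewrite chiD.
Qed.

Lemma complete_square (s : F) u : s != 0 ->
  \sum_(m : 'rV[F]_d) chi (dot m u - (4%:R * s)^-1 * sqnorm m) =
  gauss_sum (- (4%:R * s)^-1) ^+ d * chi (s * sqnorm u).
Proof.
(* The vector 2 s u is the critical point of the quadratic exponent, so the shift removes its linear
   term. *)
move=> s0; rewrite (reindex_inj (addrI ((2%:R * s) *: u))) /=.
rewrite -sum_chi_sqnorm mulr_suml; apply: eq_bigr => m _; rewrite -chiD.
congr chi; rewrite /dot /sqnorm !mulr_sumr -sumrB -big_split /=.
apply: eq_bigr => i _; rewrite !mxE.
have two0 := two_neq0 F oddq.
have four0 : (4%:R : F) != 0 by rewrite (natrM F 2 2) mulf_neq0.
by field; rewrite s0 four0.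
Qed.

(** Each pair (x, y) contributes a quadratic exponential sum to the left side, evaluated by
    [complete_square]. A common [c] exists for even d by [gauss_sum_even_power]. *)
Lemma fourier_duality E (c : algC) :
  (forall s, s != 0 -> gauss_sum s ^+ d = c) -> forall s, s != 0 ->
  fourier (spectral_mass E) (- (4%:R * s)^-1) =
  c * fourier (fun t => (pair_count E t)%:R) s.
Proof.
move=> gc s s0; rewrite fourier_spectral_mass fourier_pair_count mulr_sumr.
apply: eq_bigr => x _; rewrite mulr_sumr; apply: eq_bigr => y _.
under eq_bigr do rewrite mulNr.
rewrite complete_square // gc // oppr_eq0 invr_eq0 mulf_neq0 //.
by rewrite (natrM F 2 2) mulf_neq0 // two_neq0.
Qed.

(** The duality covers only nonzero frequencies, so frequency 0 is split off here and in
    [plancherel_neq0]. *)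
Lemma sum_fourier_neq0 (a : F -> algC) :
  \sum_(s | s != 0) fourier a s = q * a 0 - \sum_t a t.
Proof.
by rewrite -sum_fourier [in RHS](bigD1 0) //= fourier0 addrAC subrr add0r.
Qed.

Lemma plancherel_neq0 (a b : F -> algC) :
  \sum_(s | s != 0) fourier a s * fourier b (- s) =
  q * (\sum_t a t * b t) - (\sum_t a t) * (\sum_t b t).
Proof.
by rewrite -plancherel [in RHS](bigD1 0) //= oppr0 !fourier0 addrAC subrr add0r.
Qed.

Lemma fourier_scale (a : F -> algC) (r s : F) : r != 0 ->
  fourier (fun t => a (r * t)) s = fourier a (s / r).
Proof.
move=> r0; rewrite [RHS](reindex_inj (mulfI r0)); apply: eq_bigr => t _.
by rewrite mulrA divfK.
Qed.

Lemma sum_dual_frequency (f : F -> algC) :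
  \sum_(s | s != 0) f (- (4%:R * s)^-1) = \sum_(s | s != 0) f s.
Proof.
have four0 : (4%:R : F) != 0 by rewrite (natrM F 2 2) mulf_neq0 // two_neq0.
(* As 0^-1 = 0, this map is injective on the whole field and fixes 0, so it permutes the nonzero
   elements. *)
have inj : injective (fun s : F => - (4%:R * s)^-1).
  by move=> s t /oppr_inj/invr_inj/(mulfI four0).
rewrite [RHS](reindex_inj inj) /=; apply: eq_bigl => s.
by rewrite oppr_eq0 invr_eq0 mulf_eq0 (negPf four0).
Qed.

Lemma sum_pair_count E : \sum_t (pair_count E t)%:R = #|E|%:R ^+ 2 :> algC.
Proof.
rewrite -fourier0 fourier_pair_count expr2 mulr_natr -sumr_const.
apply: eq_bigr => x _; rewrite -sumr_const; apply: eq_bigr => y _.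
by rewrite mul0r.
Qed.

Lemma sum_scale (a : F -> algC) (r : F) : r != 0 ->
  \sum_t a (r * t) = \sum_t a t.
Proof. by move=> r0; rewrite [RHS](reindex_inj (mulfI r0)). Qed.

Lemma pair_count0_spectral E (c : algC) :
  (forall s, s != 0 -> gauss_sum s ^+ d = c) ->
  c * (q * (pair_count E 0)%:R - #|E|%:R ^+ 2) =
  q * spectral_mass E 0 - q ^+ d * #|E|%:R.
Proof.
move=> gc; rewrite -sum_spectral_mass -sum_pair_count -sum_fourier_neq0.
rewrite -(sum_fourier_neq0 (fun t => (pair_count E t)%:R)).
rewrite -[RHS]sum_dual_frequency mulr_sumr; apply: eq_bigr => s s0.
by rewrite (fourier_duality E c gc).
Qed.

(** Dilating nu by r divides its frequency by r, and s -> -1/(4s) turns this into multiplication by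
    r, that is, dilation of B by r^-1. *)
Lemma pair_count_correlation E (c : algC) (r : F) :
  (forall s, s != 0 -> gauss_sum s ^+ d = c) -> r != 0 ->
  c ^+ 2 * (q * (\sum_t pair_count E (r * t)%R * pair_count E t)%N%:R
            - #|E|%:R ^+ 4) =
  q * (\sum_t spectral_mass E (r^-1 * t) * spectral_mass E t)
  - (q ^+ d * #|E|%:R) ^+ 2.
Proof.
move=> gc r0; set nu : F -> algC := fun t => (pair_count E t)%:R.
have -> : #|E|%:R ^+ 4 = (\sum_t nu (r * t)) * (\sum_t nu t).
  by rewrite sum_scale // !sum_pair_count -exprD.
have -> : (q ^+ d * #|E|%:R) ^+ 2 =
    (\sum_t spectral_mass E (r^-1 * t)) * (\sum_t spectral_mass E t).
  by rewrite sum_scale ?invr_neq0 // !sum_spectral_mass expr2.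
rewrite natr_sum; under [X in q * X]eq_bigr do rewrite natrM.
rewrite -!plancherel_neq0 -[RHS]sum_dual_frequency mulr_sumr.
apply: eq_bigr => s s0.
rewrite (fourier_scale nu) // (fourier_scale (spectral_mass E)) ?invr_neq0 //.
rewrite expr2 mulrACA.
rewrite -!(fourier_duality E c gc) ?oppr_eq0 ?mulf_neq0 ?invr_neq0 //.
congr (fourier _ _ * fourier _ _); rewrite ?invrK ?mulrN ?invrN //.
by rewrite mulrA invfM invrK mulNr.
Qed.

Lemma pair_count0_sqr_lt E (r : F) : ~~ odd d -> r != 0 ->
  (9 * #|F| ^ (d %/ 2) <= #|E|)%N ->
  (pair_count E 0%R ^ 2 < \sum_t pair_count E (r * t)%R * pair_count E t)%N.
Proof.
move=> even_d r0 largeE.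
have [e gc] := gauss_sum_even_power d even_d.
have := pair_count0_spectral E _ gc.
have := pair_count_correlation E _ r gc r0.
set v := pair_count E 0; set N := (\sum_t _)%N.
set k := (#|F| ^ (d %/ 2))%N in largeE *.
have kE : q ^+ (d %/ 2) = k%:R by rewrite natrX.
have qd : q ^+ d = k%:R ^+ 2 by rewrite -kE -exprM divnK // dvdn2.
rewrite kE qd.
set B := spectral_mass E 0 => corr zero.
set S := \sum_t _ * _ in corr.
have q1 : (1 < #|F|)%N := finNzRing_gt1 F.
have q3 : (3 <= #|F|)%N by move: oddq q1; case: #|F| => [|[|[|]]].
have q0 : 0 < q by rewrite ltr0n ltnW.
have k0 : (0 < k)%N by rewrite expn_gt0 ltnW.
clearbody k.
have kC0 : 0 < (k%:R : algC) by rewrite ltr0n.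
have sg2 : ((-1) ^+ e) ^+ 2 = 1 :> algC by rewrite sqrr_sign.
(* This is q B(0) / k, written as an integer because the numeric lemma needs a totally ordered ring,
   which [algC] is not. *)
have [m mdef] : exists m : int,
    m = (-1) ^+ e * (#|F|%:R * v%:R - #|E|%:R ^+ 2) + k%:R * #|E|%:R.
  by eexists.
have mE : m%:~R =
    (-1) ^+ e * (q * v%:R - #|E|%:R ^+ 2) + k%:R * #|E|%:R :> algC.
  by rewrite mdef !(rmorphD, rmorphM, rmorphN, rmorph1, rmorphXn, rmorph_nat).
have qB : k%:R * m%:~R = q * B.
  by rewrite mE mulrDr mulrA [k%:R * _]mulrC zero; ring.
have B0 : 0 <= B by exact: spectral_mass_ge0.
have Ble : B <= k%:R ^+ 2 * #|E|%:R.
  rewrite -qd -sum_spectral_mass (bigD1 0) //= lerDl.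
  by apply: sumr_ge0 => t _; exact: spectral_mass_ge0.
have BB : B ^+ 2 <= S.
  rewrite /S (bigD1 0) //= mulr0 -expr2 lerDl.
  by apply: sumr_ge0 => t _; rewrite mulr_ge0 // spectral_mass_ge0.
rewrite -(ltr_nat int) natrX.
apply: (sqr_lt_of_spectral_bound _ #|F|%:R k%:R #|E|%:R m).
- by rewrite ler_nat.
- by rewrite ler1n.
- by rewrite -natrM ler_nat.
- apply/andP; split; rewrite -(ler_int algC) -(ler_pM2l kC0) qB.
    by rewrite mulr0 mulr_ge0 // ltW.
  rewrite !rmorphM !rmorph_nat.
  have -> : k%:R * (q * k%:R * #|E|%:R) = q * (k%:R ^+ 2 * #|E|%:R) by ring.
  by rewrite ler_pM2l.
- exact: ler0n.
- rewrite -(ler_int algC).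
  rewrite !(rmorphD, rmorphN, rmorphXn, rmorphM, rmorph_nat) /=.
  rewrite -(ler_pM2l (exprn_gt0 2 kC0)) -subr_ge0.
  (* Scaled by k^2, the slack in the required bound is exactly q^2 times the terms of [S] other than
     t = 0. *)
  have -> : k%:R ^+ 2 * (q ^+ 2 * N%:R) -
      k%:R ^+ 2 * (q * #|E|%:R ^+ 4 + m%:~R ^+ 2
                   - q * k%:R ^+ 2 * #|E|%:R ^+ 2) = q ^+ 2 * (S - B ^+ 2).
    rewrite exprMn sg2 mul1r in corr.
    transitivity (q * (k%:R ^+ 2 * (q * N%:R - #|E|%:R ^+ 4))
      - (k%:R * m%:~R) ^+ 2 + q * (k%:R ^+ 2 * #|E|%:R) ^+ 2); first by ring.
    by rewrite corr qB; ring.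
  by rewrite mulr_ge0 ?exprn_ge0 ?subr_ge0 // ltW.
by rewrite mdef addrK; case: (e); [right|left]; ring.
Qed.

End Distances.

End GaussSums.

(** * From counts to ratios of distances *)

Section QuotientSet.
Import Order.TTheory GRing.Theory Num.Theory.
Local Open Scope ring_scope.

Lemma pair_count_gt0P (F : finFieldType) (d : nat) (E : {set 'rV[F]_d}) t :
  reflect (t \in distance_set E) (0 < pair_count F d E t)%N.
Proof.
rewrite lt0n; apply: (iffP idP) => [nz|/imset2P[x y xE yE ->]].
  apply: contraNT nz => tD; apply/eqP.
  rewrite /pair_count big1 // => x xE; rewrite big1 // => y yE.
  apply/eqP; rewrite eqb0; apply: contra tD => /eqP <-.
  exact: imset2_f.
by rewrite /pair_count (bigD1 x) //= (bigD1 y) //= eqxx.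
Qed.

(** The term t = 0 of the correlation equals nu(0)^2, so the strict inequality forces a positive
    term at some nonzero t. *)
Lemma exists_distance_ratio (F : finFieldType) (d : nat) (E : {set 'rV[F]_d})
    (r : F) :
  odd #|F| -> ~~ odd d -> (9 * #|F| ^ (d %/ 2) <= #|E|)%N -> r != 0 ->
  exists t, [/\ t != 0, t \in distance_set E & r * t \in distance_set E].
Proof.
move=> oddq even_d largeE r0.
have [chi [chiD chiN chi0 chi_nt]] := exists_additive_character F.
have :=
  pair_count0_sqr_lt F chi oddq chiD chiN chi0 chi_nt d E r even_d r0 largeE.
rewrite (bigD1 0) //= mulr0 mulnn -[X in (X < _)%N]addn0 ltn_add2l lt0n.
rewrite sum_nat_eq0 negb_forall => /existsP[t].
rewrite negb_imply muln_eq0 negb_or -!lt0n => /and3P[t0 rtE tE].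
by exists t; split=> //; apply/pair_count_gt0P.
Qed.

End QuotientSet.

(* q = #|F|. The field has odd characteristic: in characteristic 2 the form
   x_1^2 + ... + x_d^2 is the square of a linear form and the claim fails. *)
Theorem theorem1p1 (F : finFieldType) (d : nat) (E : {set 'rV[F]_d})
  (oddq : odd #|F|) (d_ge2 : 2 <= d) (d_even : ~~ odd d)
  (E_large : 9 * #|F| ^ (d %/ 2) <= #|E|) :
  [set: F] = quotient_set (distance_set E).
Proof.
apply/esym/setP => r; rewrite in_setT.
have [r0|r0] := eqVneq r 0%R.
  (* Ratio 1 serves to supply a nonzero denominator; the numerator 0 is the distance from a point to
     itself. *)
  have [t [t0 tE _]] :=
    exists_distance_ratio F d E _ oddq d_even E_large GRing.oner_neq0.
  have [x xE] : exists x, x \in E.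
    apply/card_gt0P; apply: leq_trans E_large.
    by rewrite muln_gt0 expn_gt0 (ltnW (finNzRing_gt1 F)).
  apply/imset2P; exists 0%R t; rewrite ?inE ?t0 ?r0 ?GRing.mul0r //.
  apply/imset2P; exists x x; rewrite // GRing.subrr /sqnorm big1 // => i _.
  by rewrite mxE GRing.expr0n.
have [t [t0 tE rtE]] := exists_distance_ratio F d E r oddq d_even E_large r0.
by apply/imset2P; exists (r * t)%R t; rewrite ?inE ?t0 // GRing.mulfK.
Qed.
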